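(* Working internally in two-level type theory, assume a fibrant replacement structure: for every strict type $A : \mathcal{U}^s$ a fibrant type $R(A) : \mathcal{U}$, a map $\eta : A\to R(A)$, and for every fibrant type $X:\mathcal{U}$ an operation $\mathsf{elim}^X : (A\to X)\to R(A)\to X$ such that $\mathsf{elim}^X(f)(\eta(a)) = f(a)$ (fibrant equality) for all $f : A\to X$ and $a:A$. Then every fibrant type is a set, i.e. for every fibrant type $A$, every $x:A$ and every $p : x = x$ we have $\mathsf{refl} = p$.
   Context: Two-level type theory has fibrant types (universe $\mathcal{U}$; $\Pi$, $\Sigma$, unit, intensional identity types $x = y$ with $\mathsf{refl}$ and path induction, etc., as in homotopy type theory) and strict types (universe $\mathcal{U}^s$; $\Pi$, $\Sigma$, unit, strict equality $x =_s y$ satisfying UIP and function extensionality); every fibrant type is also a strict type, and the coercion from fibrant to strict types is compatible with $\Pi$, $\Sigma$ and unit. In particular for fibrant $A$ and $x,y : A$, both $x = y$ (fibrant) and $x =_s y$ (strict) are available. *)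

(* Defs.v *)
(* The judgements of two-level type theory are encoded in the style of a
   logical framework: types of the object theory are elements of a carrier
   (there is one carrier for the strict universe and one for the fibrant
   universe), terms of a type form a Rocq type, dependency on a context is a
   Rocq function, and judgemental equality is Rocq's [=].  The Rocq product
   [forall] is thus the framework product; the object-level function types are
   [sPi] and [fPi]. *)

Record strict_theory := StrictTheory {
  sty : Type;
  tm : sty -> Type;

  sUnit : sty;
  sstar : tm sUnit;
  sunit_elim : forall C : tm sUnit -> sty,
    tm (C sstar) -> forall u : tm sUnit, tm (C u);
  sunit_beta : forall (C : tm sUnit -> sty) (d : tm (C sstar)),
    sunit_elim C d sstar = d;

  sPi : forall A : sty, (tm A -> sty) -> sty;
  slam : forall {A : sty} {B : tm A -> sty},
    (forall a : tm A, tm (B a)) -> tm (sPi A B);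
  sapp : forall {A : sty} {B : tm A -> sty},
    tm (sPi A B) -> forall a : tm A, tm (B a);
  spi_beta : forall (A : sty) (B : tm A -> sty)
    (f : forall a : tm A, tm (B a)) (a : tm A), sapp (slam f) a = f a;
  spi_eta : forall (A : sty) (B : tm A -> sty) (f : tm (sPi A B)),
    slam (fun a => sapp f a) = f;

  sSigma : forall A : sty, (tm A -> sty) -> sty;
  spair : forall {A : sty} {B : tm A -> sty} (a : tm A),
    tm (B a) -> tm (sSigma A B);
  ssigma_elim : forall {A : sty} {B : tm A -> sty} (C : tm (sSigma A B) -> sty),
    (forall (a : tm A) (b : tm (B a)), tm (C (spair a b))) ->
    forall w : tm (sSigma A B), tm (C w);
  ssigma_beta : forall (A : sty) (B : tm A -> sty) (C : tm (sSigma A B) -> sty)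
    (d : forall (a : tm A) (b : tm (B a)), tm (C (spair a b)))
    (a : tm A) (b : tm (B a)), ssigma_elim C d (spair a b) = d a b;

  sEq : forall {A : sty}, tm A -> tm A -> sty;
  srefl : forall {A : sty} (x : tm A), tm (sEq x x);
  sJ : forall {A : sty} {x : tm A} (C : forall y : tm A, tm (sEq x y) -> sty),
    tm (C x (srefl x)) -> forall {y : tm A} (e : tm (sEq x y)), tm (C y e);
  sJ_beta : forall (A : sty) (x : tm A)
    (C : forall y : tm A, tm (sEq x y) -> sty) (d : tm (C x (srefl x))),
    sJ C d (srefl x) = d;
  sUIP : forall {A : sty} {x y : tm A} (e e' : tm (sEq x y)), tm (sEq e e');
  sfunext : forall {A : sty} {B : tm A -> sty} (f g : tm (sPi A B)),
    (forall a : tm A, tm (sEq (sapp f a) (sapp g a))) -> tm (sEq f g)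
}.

Arguments tm {s} A.
Arguments sPi {s} A B.
Arguments slam {s A B} f.
Arguments sapp {s A B} f a.
Arguments sSigma {s} A B.
Arguments spair {s A B} a b.
Arguments ssigma_elim {s A B} C d w.
Arguments sEq {s A} x y.
Arguments srefl {s A} x.
Arguments sJ {s A x} C d {y} e.
Arguments sUIP {s A x y} e e'.
Arguments sfunext {s A B} f g h.

Definition sArr {S : strict_theory} (A B : sty S) : sty S := sPi A (fun _ => B).

(* Judgemental isomorphism of strict types. *)
Record strict_iso {S : strict_theory} (A B : sty S) := StrictIso {
  iso_to : tm A -> tm B;
  iso_from : tm B -> tm A;
  iso_toK : forall a : tm A, iso_from (iso_to a) = a;
  iso_fromK : forall b : tm B, iso_to (iso_from b) = b
}.

(* The terms of a fibrant type [A] are the terms of the strict type [coe A].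
   The rules of the fibrant unit, dependent product and dependent sum are those
   of their strict counterparts, transported along the compatibility
   isomorphisms; a coercion commuting on the nose with the type formers is the
   case of identity isomorphisms.  Fibrant path induction [fJ] eliminates into
   families of fibrant types only. *)
Record two_level_theory := TwoLevelTheory {
  strict :> strict_theory;
  fty : Type;
  coe : fty -> sty strict;

  fUnit : fty;
  coe_unit : strict_iso (coe fUnit) (sUnit strict);

  fPi : forall A : fty, (tm (coe A) -> fty) -> fty;
  coe_pi : forall (A : fty) (B : tm (coe A) -> fty),
    strict_iso (coe (fPi A B)) (sPi (coe A) (fun a => coe (B a)));

  fSigma : forall A : fty, (tm (coe A) -> fty) -> fty;
  coe_sigma : forall (A : fty) (B : tm (coe A) -> fty),
    strict_iso (coe (fSigma A B)) (sSigma (coe A) (fun a => coe (B a)));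

  fId : forall {A : fty}, tm (coe A) -> tm (coe A) -> fty;
  frefl : forall {A : fty} (x : tm (coe A)), tm (coe (fId x x));
  fJ : forall {A : fty} {x : tm (coe A)}
    (C : forall y : tm (coe A), tm (coe (fId x y)) -> fty),
    tm (coe (C x (frefl x))) ->
    forall {y : tm (coe A)} (p : tm (coe (fId x y))), tm (coe (C y p));
  fJ_beta : forall (A : fty) (x : tm (coe A))
    (C : forall y : tm (coe A), tm (coe (fId x y)) -> fty)
    (d : tm (coe (C x (frefl x)))), fJ C d (frefl x) = d
}.

Arguments coe {t} A.
Arguments fPi {t} A B.
Arguments fSigma {t} A B.
Arguments fId {t A} x y.
Arguments frefl {t A} x.
Arguments fJ {t A x} C d {y} p.

Definition ftm {T : two_level_theory} (A : fty T) : Type := tm (coe A).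

Record fibrant_replacement (T : two_level_theory) := FibrantReplacement {
  repl : sty T -> fty T;
  eta : forall A : sty T, tm (sArr A (coe (repl A)));
  elim : forall (A : sty T) (X : fty T),
    tm (sArr (sArr A (coe X)) (sArr (coe (repl A)) (coe X)));
  elim_eta : forall (A : sty T) (X : fty T)
    (f : tm (sArr A (coe X))) (a : tm A),
    ftm (fId (sapp (sapp (elim A X) f) (sapp (eta A) a)) (sapp f a))
}.

Arguments repl {T} _ A.
Arguments eta {T} _ A.
Arguments elim {T} _ A X.
Arguments elim_eta {T} _ A X f a.

(* Main.v *)
(** Path induction eliminates into fibrant families only, and [R] makes the
    strict equality [(x, refl) =_s (y, q)] of the total space into such a family
    over [q : x = y], inhabited at [(x, refl)].  Hence it is inhabited at
    [(x, p)].  The recursor of [R] into the fibrant type [refl = p] gives back an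
    actual strict equality [(x, refl) =_s (x, p)], whose first component is
    trivial by strict UIP, so that [refl =_s p] and thus [refl = p]. *)

Require Import Defs.

Definition stransport {S : strict_theory} {A : sty S} (P : tm A -> sty S)
  {x y : tm A} (e : tm (sEq x y)) (u : tm (P x)) : tm (P y) :=
  sJ (fun z _ => P z) u e.

Lemma stransport_refl {S : strict_theory} {A : sty S} (P : tm A -> sty S)
  {x : tm A} (u : tm (P x)) : stransport P (srefl x) u = u.
Proof. exact (sJ_beta S A x (fun z _ => P z) u). Qed.

(* Strict equality of [(x, u)] and [(y, v)] in the total space of [P]. *)
Definition sPathOver {S : strict_theory} {A : sty S} (P : tm A -> sty S)
  {x y : tm A} (u : tm (P x)) (v : tm (P y)) : sty S :=
  sSigma (sEq x y) (fun e => sEq (stransport P e u) v).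

Lemma sPathOver_refl {S : strict_theory} {A : sty S} (P : tm A -> sty S)
  {x : tm A} (u : tm (P x)) : tm (sPathOver P u u).
Proof.
apply (spair (srefl x)).
rewrite stransport_refl.
exact (srefl u).
Qed.

Lemma sPathOver_loop {S : strict_theory} {A : sty S} (P : tm A -> sty S)
  {x : tm A} {u v : tm (P x)} (w : tm (sPathOver P u v)) : tm (sEq u v).
Proof.
refine (ssigma_elim (fun _ => sEq u v) (fun e h => _) w).
refine (stransport (fun v' => sEq u v') h _).
(* Both endpoints of [e] are [x], so [sJ] cannot contract it directly; [sUIP] replaces it by
   [srefl x], where transport computes. *)
refine (stransport (fun e' => sEq u (stransport P e' u)) (sUIP (srefl x) e) _).
rewrite stransport_refl.
exact (srefl u).
Qed.

(** [sJ] eliminates into any strict family, hence into the coerced family [fId x z]. *)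
Lemma fId_of_sEq {T : two_level_theory} {A : fty T} {x y : ftm A}
  (e : tm (sEq x y)) : ftm (fId x y).
Proof. exact (stransport (fun z => coe (fId x z)) e (frefl x)). Qed.

Lemma repl_rec {T : two_level_theory} (R : fibrant_replacement T) {A : sty T}
  {X : fty T} (f : tm A -> ftm X) (r : ftm (repl R A)) : ftm X.
Proof. exact (sapp (sapp (elim R A X) (slam f)) r). Qed.

Theorem mainTheorem6 (T : two_level_theory) (R : fibrant_replacement T)
  (A : fty T) (x : ftm A) (p : ftm (fId x x)) :
  ftm (fId (frefl x) p).
Proof.
pose (P := fun y : ftm A => coe (fId x y)).
refine (repl_rec R (fun w => fId_of_sEq (sPathOver_loop P w)) _).
(* The endpoint [y] must vary for [fJ], and then [frefl x] and [q] have different types: hence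
   [sPathOver] instead of [sEq]. *)
refine (fJ (fun y q => repl R (sPathOver P (frefl x) (q : tm (P y)))) _ p).
exact (sapp (eta R _) (sPathOver_refl P (frefl x))).
Qed.
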